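(* Let $(A,\prec_A,\succ_A,\omega)$ be a quadratic dendriform algebra. Let $(B,\dashv_B,\vdash_B,\Delta_{\dashv_B},\Delta_{\vdash_B})$ be a diassociative bialgebra and let $((B\oplus B^*,\dashv_d,\vdash_d,\omega_d),(B,\dashv_B,\vdash_B),(B^*,\dashv_{B^*},\vdash_{B^*}))$ be the corresponding standard Manin triple of diassociative algebras. Put $\mathfrak{g}=A\otimes B$ and $\mathfrak{g}^*=A^*\otimes B^*$, with the Lie brackets $[-,-]_{\mathfrak{g}}$, $[-,-]_{\mathfrak{g}^*}$, and let $[-,-]'_d$ be the bracket on $\mathfrak{g}\oplus\mathfrak{g}^*$, all as defined in the context. Then $((\mathfrak{g}\oplus\mathfrak{g}^*,[-,-]'_d,\mathcal{B}_s),(\mathfrak{g},[-,-]_{\mathfrak{g}}),(\mathfrak{g}^*,[-,-]_{\mathfrak{g}^*}))$ is a standard Manin triple of Lie algebras. Consequently, $(\mathfrak{g},[-,-]_{\mathfrak{g}},\delta)$ is a Lie bialgebra, where $\delta$ is the linear dual of $[-,-]_{\mathfrak{g}^*}$.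
   Context: All vector spaces are finite-dimensional over a field $\mathbf{k}$ of characteristic $0$. $\sigma(u\otimes v)=v\otimes u$; $L_\diamond(x)y=x\diamond y$, $R_\diamond(y)x=x\diamond y$; for $\rho:B\to\mathrm{End}(V)$, $\langle\rho^*(x)u^*,v\rangle=\langle u^*,\rho(x)v\rangle$ (no sign). The linear dual of an operation $*$ on $V^*$ is $\Delta:V\to V\otimes V$ with $\langle\Delta(x),a^*\otimes b^*\rangle=\langle x,a^* * b^*\rangle$. Dendriform algebra $(A,\prec,\succ)$: with $x\ast y:=x\prec y+x\succ y$, $(x\prec y)\prec z=x\prec(y\ast z)$, $(x\succ y)\prec z=x\succ(y\prec z)$, $(x\ast y)\succ z=x\succ(y\succ z)$. It is quadratic with $\omega$ if $\omega$ is a nondegenerate antisymmetric bilinear form with $\omega(x\prec y,z)=\omega(x,y\ast z)$, $\omega(x\succ y,z)=\omega(y,z\ast x)$. Diassociative algebra $(B,\dashv,\vdash)$: $(x\dashv y)\dashv z=x\dashv(y\dashv z)=x\dashv(y\vdash z)$; $(x\vdash y)\dashv z=x\vdash(y\dashv z)$; $(x\vdash y)\vdash z=(x\dashv y)\vdash z=x\vdash(y\vdash z)$. Put $\bullet:=\vdash-\dashv$. It is quadratic with $\omega$ if $\omega$ is nondegenerate antisymmetric with $\omega(x,y\dashv z)=\omega(z,x\bullet y)$, $\omega(x\vdash y,z)=\omega(x,y\bullet z)$. A standard Manin triple of diassociative algebras $((B\oplus B^*,\dashv_d,\vdash_d,\omega_d),(B,\dashv_B,\vdash_B),(B^*,\dashv_{B^*},\vdash_{B^*}))$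 means: $(B\oplus B^*,\dashv_d,\vdash_d,\omega_d)$ is a quadratic diassociative algebra with $\omega_d(x+a^*,y+b^* )=\langle a^*,y\rangle-\langle x,b^*\rangle$, and $B$, $B^*$ are subalgebras with the given operations. Diassociative coalgebra $(B,\Delta_{\dashv},\Delta_{\vdash})$: $(\mathrm{id}\otimes\Delta_{\dashv})\Delta_{\dashv}=(\mathrm{id}\otimes\Delta_{\vdash})\Delta_{\dashv}=(\Delta_{\dashv}\otimes\mathrm{id})\Delta_{\dashv}$; $(\Delta_{\vdash}\otimes\mathrm{id})\Delta_{\dashv}=(\mathrm{id}\otimes\Delta_{\dashv})\Delta_{\vdash}$; $(\Delta_{\dashv}\otimes\mathrm{id})\Delta_{\vdash}=(\Delta_{\vdash}\otimes\mathrm{id})\Delta_{\vdash}=(\mathrm{id}\otimes\Delta_{\vdash})\Delta_{\vdash}$. Diassociative bialgebra $(B,\dashv,\vdash,\Delta_{\dashv},\Delta_{\vdash})$: a diassociative algebra and diassociative coalgebra such that, with $\Delta_{\bullet}:=\Delta_{\vdash}-\Delta_{\dashv}$, for all $x,y\in B$: (1) $\Delta_{\vdash}(x\dashv y)=(\mathrm{id}\otimes L_{\dashv}(x))\Delta_{\vdash}(y)-(R_{\bullet}(y)\otimes\mathrm{id})\Delta_{\vdash}(x)=(\mathrm{id}\otimes L_{\dashv}(x))\Delta_{\bullet}(y)+(R_{\dashv}(y)\otimes\mathrm{id})\Delta_{\vdash}(x)$; (2) $\sigma((L_{\vdash}(y)\otimes\mathrm{id})\Delta_{\vdash}(x))-(L_{\dashv}(x)\otimes\mathrm{id})\Delta_{\bullet}(y)=(L_{\dashv}(x)\otimes\mathrm{id})\Delta_{\dashv}(y)+\sigma((L_{\bullet}(y)\otimes\mathrm{id})\Delta_{\vdash}(x))=\sigma((\mathrm{id}\otimes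 R_{\dashv}(y))\Delta_{\vdash}(x))+(\mathrm{id}\otimes R_{\bullet}(x))\Delta_{\bullet}(y)$; (3) $\sigma((\mathrm{id}\otimes R_{\vdash}(y))\Delta_{\vdash}(x))-(\mathrm{id}\otimes R_{\bullet}(x))\Delta_{\dashv}(y)=(\mathrm{id}\otimes R_{\dashv}(x))\Delta_{\dashv}(y)+\sigma((\mathrm{id}\otimes R_{\vdash}(y))\Delta_{\bullet}(x))=(L_{\vdash}(x)\otimes\mathrm{id})\Delta_{\dashv}(y)+\sigma((L_{\bullet}(y)\otimes\mathrm{id})\Delta_{\bullet}(x))$; (4) $\Delta_{\dashv}(x\vdash y)=(\mathrm{id}\otimes L_{\vdash}(x))\Delta_{\dashv}(y)-(R_{\vdash}(y)\otimes\mathrm{id})\Delta_{\bullet}(x)=(\mathrm{id}\otimes L_{\bullet}(x))\Delta_{\dashv}(y)+(R_{\vdash}(y)\otimes\mathrm{id})\Delta_{\dashv}(x)$; (5) $\Delta_{\dashv}(x\dashv y)=(R_{\dashv}(y)\otimes\mathrm{id})\Delta_{\dashv}(x)-(\mathrm{id}\otimes L_{\bullet}(x))\Delta_{\bullet}(y)$; (6) $\Delta_{\vdash}(x\vdash y)=(\mathrm{id}\otimes L_{\vdash}(x))\Delta_{\vdash}(y)-(R_{\bullet}(y)\otimes\mathrm{id})\Delta_{\bullet}(x)$. Corresponding Manin triple: $\dashv_{B^*},\vdash_{B^*}$ are the operations on $B^*$ whose linear duals are $\Delta_{\dashv_B},\Delta_{\vdash_B}$; $\dashv_d,\vdash_d$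 extend the operations of $B$ and $B^*$, with mixed products $x\dashv_d a^*=L^*_{\vdash_{B^*}}(a^* )x-R^*_{\bullet_B}(x)a^*$, $a^*\dashv_d x=-R^*_{\bullet_{B^*}}(a^* )x+L^*_{\vdash_B}(x)a^*$, $x\vdash_d a^*=L^*_{\bullet_{B^*}}(a^* )x+R^*_{\dashv_B}(x)a^*$, $a^*\vdash_d x=R^*_{\dashv_{B^*}}(a^* )x+L^*_{\bullet_B}(x)a^*$. Tensor bracket: for a dendriform algebra $(A,\prec,\succ)$ and a diassociative algebra $(E,\dashv,\vdash)$, $A\otimes E$ is a Lie algebra with $[x\otimes a,y\otimes b]=x\succ y\otimes a\vdash b+x\prec y\otimes a\dashv b-y\succ x\otimes b\vdash a-y\prec x\otimes b\dashv a$. Let $[-,-]_{\mathfrak{g}}$ be this bracket on $\mathfrak{g}=A\otimes B$, and $[-,-]_d$ this bracket on $A\otimes(B\oplus B^* )$ with $(B\oplus B^*,\dashv_d,\vdash_d)$. Let $\varphi:A\to A^*$, $\langle\varphi(x),y\rangle=\omega(x,y)$; give $A^*$ the dendriform operations $a^*\prec_{A^*}b^*=\varphi(\varphi^{-1}(a^* )\prec_A\varphi^{-1}(b^* ))$, $a^*\succ_{A^*}b^*=\varphi(\varphi^{-1}(a^* )\succ_A\varphi^{-1}(b^* ))$, and let $[-,-]_{\mathfrak{g}^*}$ be the tensor bracket on $\mathfrak{g}^*=A^*\otimes B^*$ (identified with the dual of $\mathfrak{g}$) from $(A^*,\prec_{A^*},\succ_{A^*})$ and $(B^*,\dashv_{B^*},\vdash_{B^*})$.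 Let $f:A\otimes(B\oplus B^* )\to\mathfrak{g}\oplus\mathfrak{g}^*$ be the linear isomorphism $f(x\otimes a+y\otimes b^* )=x\otimes a+\varphi(y)\otimes b^*$, and let $[X,Y]'_d:=f([f^{-1}(X),f^{-1}(Y)]_d)$ for $X,Y\in\mathfrak{g}\oplus\mathfrak{g}^*$. A standard Manin triple of Lie algebras $((\mathfrak{g}\oplus\mathfrak{g}^*,[-,-],\mathcal{B}_s),(\mathfrak{g},[-,-]_{\mathfrak{g}}),(\mathfrak{g}^*,[-,-]_{\mathfrak{g}^*}))$: $(\mathfrak{g}\oplus\mathfrak{g}^*,[-,-])$ is a Lie algebra, $\mathfrak{g},\mathfrak{g}^*$ with their brackets are Lie subalgebras, and $\mathcal{B}_s(x+a^*,y+b^* )=\langle x,b^*\rangle+\langle a^*,y\rangle$ is invariant ($\mathcal{B}_s([X,Y],Z)=\mathcal{B}_s(X,[Y,Z])$). A Lie bialgebra $(\mathfrak{g},[-,-]_{\mathfrak{g}},\delta)$ is a Lie algebra with a Lie coalgebra structure $\delta$ that is a 1-cocycle: $\delta([x,y])=(\mathrm{ad}(x)\otimes\mathrm{id}+\mathrm{id}\otimes\mathrm{ad}(x))\delta(y)-(\mathrm{ad}(y)\otimes\mathrm{id}+\mathrm{id}\otimes\mathrm{ad}(y))\delta(x)$. *)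

(* Defs.v *)
From HB Require Import structures.
From mathcomp Require Import all_boot all_order all_algebra.

Set Implicit Arguments.
Unset Strict Implicit.
Unset Printing Implicit Defensive.

Import GRing.Theory.
Local Open Scope ring_scope.

Section Linear.
Variable k : fieldType.
Implicit Types U V W : vectType k.

Definition dual V : vectType k := 'Hom(V, k^o).

Definition bilinear_map U V W (f : U -> V -> W) : Prop :=
  (forall v, linear (f ^~ v)) /\ (forall u, linear (f u)).

Lemma linfunE U V (f : U -> V) : linear f -> linfun f =1 f.
Proof.
move=> lf x.
pose m := GRing.isLinear.Build k U V _ f lf.
pose g : {linear U -> V} := HB.pack f m.
exact: (lfunE g).
Qed.

Definition bvec V (i : 'I_(\dim {:V})) : V := (vbasis {:V})`_i.
Definition bcrd V (i : 'I_(\dim {:V})) (v : V) : k := coord (vbasis {:V}) i v.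

Lemma bcrd_sum V (v : V) : v = \sum_i bcrd i v *: bvec i.
Proof. exact: coord_vbasis (memvf v). Qed.

Lemma bcrd_bvec V (i j : 'I_(\dim {:V})) : bcrd i (bvec j) = (i == j)%:R.
Proof.
have free_b := basis_free (vbasisP {:V}).
by rewrite eq_sym -(coord_free j i free_b).
Qed.

Lemma bcrd_linear V (i : 'I_(\dim {:V})) : linear (bcrd i : V -> k^o).
Proof. by move=> a u v; rewrite /bcrd linearP. Qed.

(* Model of V ⊗ W: the matrix of coordinates on the products of the vectors of
   the chosen bases.  It has the universal property: tlift_ten, tlift_linear
   and tens_ext. *)
Definition tens V W : vectType k := 'M[k]_(\dim {:V}, \dim {:W}).

Definition ten V W (v : V) (w : W) : tens V W :=
  \matrix_(i, j) (bcrd i v * bcrd j w).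

Definition tlift V W U (f : V -> W -> U) (T : tens V W) : U :=
  \sum_i \sum_j (T : 'M[k]_(_, _)) i j *: f (bvec i) (bvec j).

Lemma ten_bilinear V W : bilinear_map (@ten V W).
Proof.
split=> [w a u v | v a u w]; apply/matrixP=> i j; rewrite !mxE bcrd_linear.
  by rewrite mulrDl -mulrA.
by rewrite mulrDr mulrCA.
Qed.

Lemma tlift_linear V W U (f : V -> W -> U) : linear (tlift f).
Proof.
move=> a S T; rewrite /tlift scaler_sumr -big_split /=; apply: eq_bigr => i _.
rewrite scaler_sumr -big_split /=; apply: eq_bigr => j _.
by rewrite !mxE scalerA scalerDl.
Qed.

Lemma lin_sum U V (f : U -> V) (I : finType) (c : I -> k) (g : I -> U) :
  linear f -> f (\sum_i c i *: g i) = \sum_i c i *: f (g i).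
Proof.
move=> lf; rewrite -(linfunE lf) linear_sum; apply: eq_bigr => i _.
by rewrite linearZ /= (linfunE lf).
Qed.

Lemma tlift_ten V W U (f : V -> W -> U) :
  bilinear_map f -> forall v w, tlift f (ten v w) = f v w.
Proof.
move=> [fl fr] v w; rewrite {2}(bcrd_sum v) (lin_sum _ _ (fl w)) /tlift.
apply: eq_bigr => i _; rewrite {2}(bcrd_sum w) (lin_sum _ _ (fr _)).
by rewrite scaler_sumr; apply: eq_bigr => j _; rewrite mxE scalerA.
Qed.

Lemma tens_basis V W (T : tens V W) :
  T = tlift (@ten V W) T.
Proof.
apply/matrixP=> i j; rewrite /tlift summxE (bigD1 i) //= [X in _ + X]big1 => [|i' ne_i'i].
  rewrite addr0 summxE (bigD1 j) //= [X in _ + X]big1 => [|j' ne_j'j].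
    by rewrite !mxE !bcrd_bvec !eqxx !mulr1 addr0.
  by rewrite !mxE !bcrd_bvec (eq_sym j) (negPf ne_j'j) !mulr0.
rewrite summxE big1 // => j' _.
by rewrite !mxE !bcrd_bvec (eq_sym i) (negPf ne_i'i) mul0r mulr0.
Qed.

Lemma tens_ext V W U (f g : tens V W -> U) : linear f -> linear g ->
  (forall v w, f (ten v w) = g (ten v w)) -> f =1 g.
Proof.
move=> lf lg fg T; rewrite (tens_basis T) /tlift pair_bigA /=.
by rewrite (lin_sum _ _ lf) (lin_sum _ _ lg); apply: eq_bigr => i _; rewrite fg.
Qed.

Definition tmap V W V' W' (f : V -> V') (g : W -> W') :
  tens V W -> tens V' W' := tlift (fun v w => ten (f v) (g w)).

Definition tswap V W : tens V W -> tens W V := tlift (fun v w => ten w v).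

Definition tassoc U V W : tens (tens U V) W -> tens U (tens V W) :=
  tlift (fun T w => tlift (fun u v => ten u (ten v w)) T).

(* a ⊗ b as a functional on V ⊗ W *)
Definition dten V W (a : dual V) (b : dual W) : dual (tens V W) :=
  linfun (tlift (fun v w => a v * b w : k^o)).

Lemma dtenE V W (a : dual V) (b : dual W) v w :
  dten a b (ten v w) = a v * b w.
Proof.
rewrite linfunE; last exact: tlift_linear.
rewrite tlift_ten //; split=> [y c x x' | x c y y'].
  by rewrite linearP mulrDl -scalerAl.
by rewrite linearP mulrDr -scalerAr.
Qed.

(* The identification of V^* ⊗ W^* with (V ⊗ W)^*. *)
Definition dtens_iso V W : 'Hom(tens (dual V) (dual W), dual (tens V W)) :=
  linfun (tlift (@dten V W)).

(* The identification of V with V^**. *)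
Definition bidual V : 'Hom(V, dual (dual V)) :=
  linfun (fun v => linfun (fun a : dual V => a v) : dual (dual V)).

Definition is_linear_dual V (op : dual V -> dual V -> dual V)
    (D : V -> tens V V) : Prop :=
  forall x a b, dten a b (D x) = op a b x.

Definition op_of_coop V (D : V -> tens V V) (a b : dual V) : dual V :=
  linfun (fun x => dten a b (D x)).

Definition bvec_dual V (i : 'I_(\dim {:V})) : dual V :=
  linfun (bcrd i : V -> k^o).

Definition coop_of_op V (op : dual V -> dual V -> dual V) (x : V) : tens V V :=
  \sum_i \sum_j op (bvec_dual i) (bvec_dual j) x *: ten (bvec i) (bvec j).

Lemma op_of_coopP V (D : V -> tens V V) :
  linear D -> is_linear_dual (op_of_coop D) D.
Proof.
by move=> lD x a b; rewrite [RHS]linfunE // => c u v; rewrite lD linearP.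
Qed.

Lemma dual_sum V (a : dual V) : a = \sum_i a (bvec i) *: bvec_dual i.
Proof.
apply/lfunP => v; rewrite {1}(bcrd_sum v) linear_sum sum_lfunE.
apply: eq_bigr => i _; rewrite linearZ /= scale_lfunE linfunE; last exact: bcrd_linear.
exact: mulrC.
Qed.

Lemma coop_of_opP V (op : dual V -> dual V -> dual V) :
  bilinear_map op -> is_linear_dual op (coop_of_op op).
Proof.
move=> [opl opr] x a b; rewrite /coop_of_op linear_sum.
rewrite {2}(dual_sum a) (lin_sum _ _ (opl b)) sum_lfunE.
apply: eq_bigr => i _; rewrite {2}(dual_sum b) (lin_sum _ _ (opr _)).
rewrite scaler_sumr sum_lfunE linear_sum; apply: eq_bigr => j _.
by rewrite linearZ /= dtenE scalerA scale_lfunE /GRing.scale /= mulrC.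
Qed.

Lemma is_linear_dual_uniq V (op : dual V -> dual V -> dual V) D D' :
  is_linear_dual op D -> is_linear_dual op D' -> D =1 D'.
Proof.
move=> dD dD' x; apply/matrixP => i j.
have dE (T : tens V V) : dten (bvec_dual i) (bvec_dual j) T = (T : 'M_(_,_)) i j.
  pose g (S : tens V V) : k^o := (S : 'M_(_,_)) i j.
  rewrite -[RHS]/(g T); apply: tens_ext => [c u v | c u v | v w].
  - by rewrite linearP.
  - by rewrite /g !mxE.
  by rewrite dtenE !linfunE ?/g ?mxE //; exact: bcrd_linear.
by rewrite -!dE dD dD'.
Qed.

(* The dual map of r, with no sign: < trsp r u, v > = < u, r v >.  For
   r : V^* -> V^*, trsp_pre r : V -> V is trsp r read through V = V^**. *)
Definition trsp V (r : V -> V) (u : dual V) : dual V :=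
  linfun (fun v => u (r v)).

Definition trsp_pre V (r : dual V -> dual V) (x : V) : V :=
  (bidual V)^-1%VF (trsp r (bidual V x)).

Lemma bidualE V (x : V) (a : dual V) : bidual V x a = a x.
Proof.
rewrite linfunE; first by rewrite linfunE // => c u v; rewrite add_lfunE scale_lfunE.
move=> c u v; apply/lfunP => b.
rewrite add_lfunE scale_lfunE !linfunE ?linearP // => d s t;
  by rewrite add_lfunE scale_lfunE.
Qed.

Lemma bidual_inj V : lker (bidual V) == 0%VS.
Proof.
apply/lker0P => x y xy; rewrite (bcrd_sum x) (bcrd_sum y).
apply: eq_bigr => i _; congr (_ *: _).
have := congr1 (fun f : dual (dual V) => f (bvec_dual i)) xy.
by rewrite /= !bidualE !linfunE //; exact: bcrd_linear.
Qed.

Lemma lker0_dimK U V (f : 'Hom(U, V)) :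
  \dim {:U} = \dim {:V} -> lker f == 0%VS -> cancel f^-1%VF f.
Proof.
move=> dUV f0 u; rewrite limg_lfunVK //.
suff -> : limg f = fullv by apply: memvf.
by apply/eqP; rewrite eqEdim subvf limg_dim_eq ?dUV //= (eqP f0) capv0.
Qed.

Lemma dim_dual V : \dim {:dual V} = \dim {:V}.
Proof. by rewrite !dimvf /dim /= muln1. Qed.

Lemma trsp_preE V (r : dual V -> dual V) (a : dual V) x :
  linear r -> a (trsp_pre r x) = r a x.
Proof.
move=> lr; rewrite -bidualE /trsp_pre lker0_dimK ?bidual_inj ?dim_dual //.
by rewrite linfunE ?bidualE // => c u v; rewrite lr linearP.
Qed.

Lemma dim_tens V W : \dim {:tens V W} = (\dim {:V} * \dim {:W})%N.
Proof. by rewrite dimvf. Qed.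

Lemma dten_bilinear V W : bilinear_map (@dten V W).
Proof.
by split=> [b c a a' | a c b b']; apply/lfunP => T;
  move: T; apply: tens_ext => [d s t | d s t | v w];
  rewrite ?linearP // !(add_lfunE, scale_lfunE) !dtenE !(add_lfunE, scale_lfunE)
  ?(mulrDl, mulrDr) -?(scalerAl, scalerAr).
Qed.

Lemma dtens_isoE V W (a : dual V) (b : dual W) :
  dtens_iso V W (ten a b) = dten a b.
Proof.
rewrite linfunE; last exact: tlift_linear.
by rewrite tlift_ten //; exact: dten_bilinear.
Qed.

Lemma dtens_iso_inj V W : lker (dtens_iso V W) == 0%VS.
Proof.
have fullE : limg (dtens_iso V W) = fullv.
  apply/eqP; rewrite eqEsubv subvf; apply/subvP => g _; apply/memv_imgP.
  exists (\sum_i \sum_j g (ten (bvec i) (bvec j)) *: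
            ten (bvec_dual i) (bvec_dual j)); first exact: memvf.
  apply/lfunP; apply: tens_ext => [c s t | c s t | v w]; rewrite ?linearP //.
  have [tl tr] := ten_bilinear V W.
  rewrite {1}(bcrd_sum v) (lin_sum _ _ (tl w)) !linear_sum sum_lfunE.
  apply: eq_bigr => i _.
  rewrite {1}(bcrd_sum w) (lin_sum _ _ (tr _)) scaler_sumr !linear_sum sum_lfunE.
  apply: eq_bigr => j _; rewrite !linearZ /= dtens_isoE scale_lfunE dtenE.
  rewrite !linfunE; try exact: bcrd_linear.
  by rewrite /GRing.scale /= mulrA mulrC.
rewrite -dimv_eq0 -(eqn_add2r (\dim (limg (dtens_iso V W)))) add0n.
have := limg_ker_dim (dtens_iso V W) fullv; rewrite capfv => ->.
by rewrite fullE !(dim_dual, dim_tens).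
Qed.

Definition dsum V W : vectType k := (V * W)%type.

Definition transport U V (f : 'Hom(U, V)) (op : U -> U -> U) (X Y : V) : V :=
  f (op (f^-1%VF X) (f^-1%VF Y)).

Definition nondegenerate V (w : V -> V -> k^o) : Prop :=
  forall x, (forall y, w x y = 0) -> x = 0.

Definition antisymmetric_form V (w : V -> V -> k^o) : Prop :=
  forall x y, w x y = - w y x.

Definition Lmul V (op : V -> V -> V) (x y : V) : V := op x y.
Definition Rmul V (op : V -> V -> V) (y x : V) : V := op x y.

(* For diassociative operations dl is ⊣, dr is ⊢ and bul is ⊢ - ⊣. *)
Definition bul V (dl dr : V -> V -> V) (x y : V) : V := dr x y - dl x y.

End Linear.

Section Algebras.
Variables (k : fieldType) (V : vectType k).
Implicit Types (prec succ dl dr : V -> V -> V) (Dl Dr : V -> tens V V).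

Definition star prec succ x y := prec x y + succ x y.

Record dendriform prec succ : Prop := Dendriform {
  dend_bilin_prec : bilinear_map prec;
  dend_bilin_succ : bilinear_map succ;
  dend_prec_prec : forall x y z,
    prec (prec x y) z = prec x (star prec succ y z);
  dend_succ_prec : forall x y z, prec (succ x y) z = succ x (prec y z);
  dend_star_succ : forall x y z,
    succ (star prec succ x y) z = succ x (succ y z) }.

Record quadratic_dendriform prec succ (w : V -> V -> k^o) : Prop :=
  QuadraticDendriform {
  qdend_alg : dendriform prec succ;
  qdend_bilin : bilinear_map w;
  qdend_nondeg : nondegenerate w;
  qdend_antisym : antisymmetric_form w;
  qdend_prec : forall x y z, w (prec x y) z = w x (star prec succ y z);
  qdend_succ : forall x y z, w (succ x y) z = w y (star prec succ z x) }.

Record diassociative dl dr : Prop := Diassociative {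
  dias_bilin_l : bilinear_map dl;
  dias_bilin_r : bilinear_map dr;
  dias_ll : forall x y z, dl (dl x y) z = dl x (dl y z);
  dias_ll_r : forall x y z, dl x (dl y z) = dl x (dr y z);
  dias_rl : forall x y z, dl (dr x y) z = dr x (dl y z);
  dias_rr_l : forall x y z, dr (dr x y) z = dr (dl x y) z;
  dias_rr : forall x y z, dr (dl x y) z = dr x (dr y z) }.

Record diass_coalgebra Dl Dr : Prop := DiassCoalgebra {
  dico_lin_l : linear Dl;
  dico_lin_r : linear Dr;
  dico_ll_r : forall x, tmap id Dl (Dl x) = tmap id Dr (Dl x);
  dico_ll : forall x, tmap id Dr (Dl x) = tassoc (tmap Dl id (Dl x));
  dico_rl : forall x, tassoc (tmap Dr id (Dl x)) = tmap id Dl (Dr x);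
  dico_rr_l : forall x,
    tassoc (tmap Dl id (Dr x)) = tassoc (tmap Dr id (Dr x));
  dico_rr : forall x, tassoc (tmap Dr id (Dr x)) = tmap id Dr (Dr x) }.

Definition Dbul Dl Dr (x : V) : tens V V := Dr x - Dl x.

Record diass_bialgebra dl dr Dl Dr : Prop := DiassBialgebra {
  dibi_alg : diassociative dl dr;
  dibi_coalg : diass_coalgebra Dl Dr;
  dibi_1a : forall x y, Dr (dl x y) =
    tmap id (Lmul dl x) (Dr y) - tmap (Rmul (bul dl dr) y) id (Dr x);
  dibi_1b : forall x y, Dr (dl x y) =
    tmap id (Lmul dl x) (Dbul Dl Dr y) + tmap (Rmul dl y) id (Dr x);
  dibi_2a : forall x y,
    tswap (tmap (Lmul dr y) id (Dr x)) - tmap (Lmul dl x) id (Dbul Dl Dr y) =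
    tmap (Lmul dl x) id (Dl y) + tswap (tmap (Lmul (bul dl dr) y) id (Dr x));
  dibi_2b : forall x y,
    tmap (Lmul dl x) id (Dl y) + tswap (tmap (Lmul (bul dl dr) y) id (Dr x)) =
    tswap (tmap id (Rmul dl y) (Dr x))
      + tmap id (Rmul (bul dl dr) x) (Dbul Dl Dr y);
  dibi_3a : forall x y,
    tswap (tmap id (Rmul dr y) (Dr x)) - tmap id (Rmul (bul dl dr) x) (Dl y) =
    tmap id (Rmul dl x) (Dl y) + tswap (tmap id (Rmul dr y) (Dbul Dl Dr x));
  dibi_3b : forall x y,
    tmap id (Rmul dl x) (Dl y) + tswap (tmap id (Rmul dr y) (Dbul Dl Dr x)) =
    tmap (Lmul dr x) id (Dl y)
      + tswap (tmap (Lmul (bul dl dr) y) id (Dbul Dl Dr x));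
  dibi_4a : forall x y, Dl (dr x y) =
    tmap id (Lmul dr x) (Dl y) - tmap (Rmul dr y) id (Dbul Dl Dr x);
  dibi_4b : forall x y, Dl (dr x y) =
    tmap id (Lmul (bul dl dr) x) (Dl y) + tmap (Rmul dr y) id (Dl x);
  dibi_5 : forall x y, Dl (dl x y) =
    tmap (Rmul dl y) id (Dl x) - tmap id (Lmul (bul dl dr) x) (Dbul Dl Dr y);
  dibi_6 : forall x y, Dr (dr x y) =
    tmap id (Lmul dr x) (Dr y) - tmap (Rmul (bul dl dr) y) id (Dbul Dl Dr x) }.

(* The operations ⊣_d and ⊢_d of the Manin triple on V ⊕ V^*: they extend those
   of V (dl, dr) and of V^* (dlS, drS) by the mixed products
     x ⊣ a =   L^*_{⊢}(a) x - R^*_{•}(x) a,   a ⊣ x = - R^*_{•}(a) x + L^*_{⊢}(x) a,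
     x ⊢ a =   L^*_{•}(a) x + R^*_{⊣}(x) a,   a ⊢ x =   R^*_{⊣}(a) x + L^*_{•}(x) a. *)
Definition manin_l dl dr (dlS drS : dual V -> dual V -> dual V)
    (X Y : dsum V (dual V)) : dsum V (dual V) :=
  let: (x, a) := X in let: (y, b) := Y in
  (dl x y + trsp_pre (Lmul drS b) x
     - trsp_pre (Rmul (bul dlS drS) a) y,
   dlS a b - trsp (Rmul (bul dl dr) x) b + trsp (Lmul dr y) a).

Definition manin_r dl dr (dlS drS : dual V -> dual V -> dual V)
    (X Y : dsum V (dual V)) : dsum V (dual V) :=
  let: (x, a) := X in let: (y, b) := Y in
  (dr x y + trsp_pre (Lmul (bul dlS drS) b) x
     + trsp_pre (Rmul dlS a) y,
   drS a b + trsp (Rmul dl x) b + trsp (Lmul (bul dl dr) y) a).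

End Algebras.

Record lie_algebra (k : fieldType) (g : vectType k) (br : g -> g -> g) : Prop :=
  LieAlgebra {
  lie_bilin : bilinear_map br;
  lie_alt : forall x, br x x = 0;
  lie_jacobi : forall x y z,
    br x (br y z) + br y (br z x) + br z (br x y) = 0 }.

Section Lie.
Variables (k : fieldType) (g : vectType k).
Implicit Types (br : g -> g -> g) (D : g -> tens g g).

(* x ⊗ (y ⊗ z) |-> y ⊗ (z ⊗ x) *)
Definition tcycle (T : tens g (tens g g)) : tens g (tens g g) :=
  tassoc (tswap T).

Record lie_coalgebra D : Prop := LieCoalgebra {
  lieco_lin : linear D;
  lieco_anti : forall x, tswap (D x) = - D x;
  lieco_jacobi : forall x, let T := tmap id D (D x) in
    T + tcycle T + tcycle (tcycle T) = 0 }.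

Record lie_bialgebra br D : Prop := LieBialgebra {
  liebi_alg : lie_algebra br;
  liebi_coalg : lie_coalgebra D;
  liebi_cocycle : forall x y, D (br x y) =
    (tmap (br x) id (D y) + tmap id (br x) (D y))
      - (tmap (br y) id (D x) + tmap id (br y) (D x)) }.

Definition Bs (X Y : dsum g (dual g)) : k := Y.2 X.1 + X.2 Y.1.

Record lie_manin_triple
    (brd : dsum g (dual g) -> dsum g (dual g) -> dsum g (dual g))
    (br : g -> g -> g) (brS : dual g -> dual g -> dual g) : Prop :=
  LieManinTriple {
  liemt_alg : lie_algebra brd;
  liemt_alg_sub : lie_algebra br;
  liemt_alg_subS : lie_algebra brS;
  liemt_sub : forall x y, brd (x, 0) (y, 0) = (br x y, 0);
  liemt_subS : forall a b, brd (0, a) (0, b) = (0, brS a b);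
  liemt_inv : forall X Y Z, Bs (brd X Y) Z = Bs X (brd Y Z) }.

End Lie.

Section TensorBrackets.
Variable k : fieldType.

(* The bilinear extension of the bracket given on x ⊗ a, y ⊗ b. *)
Definition tensor_bracket (A E : vectType k) (prec succ : A -> A -> A)
    (dl dr : E -> E -> E) (X Y : tens A E) : tens A E :=
  tlift (fun x a => tlift (fun y b =>
    ten (succ x y) (dr a b) + ten (prec x y) (dl a b)
      - ten (succ y x) (dr b a) - ten (prec y x) (dl b a)) Y) X.

Lemma tlift_param (U V W X : vectType k) (h : X -> V -> W -> U) (T : tens V W) :
  (forall v w, linear (fun x => h x v w)) -> linear (fun x => tlift (h x) T).
Proof.
move=> lh c x x'; rewrite /tlift scaler_sumr -big_split /=.
apply: eq_bigr => i _; rewrite scaler_sumr -big_split /=.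
by apply: eq_bigr => j _; rewrite lh scalerDr !scalerA mulrC.
Qed.

Lemma tensor_bracket_ten (A E : vectType k) (prec succ : A -> A -> A)
    (dl dr : E -> E -> E) :
  bilinear_map prec -> bilinear_map succ -> bilinear_map dl -> bilinear_map dr ->
  forall x a y b, tensor_bracket prec succ dl dr (ten x a) (ten y b) =
    ten (succ x y) (dr a b) + ten (prec x y) (dl a b)
      - ten (succ y x) (dr b a) - ten (prec y x) (dl b a).
Proof.
move=> [pl pr] [sl sr] [ll lr] [rl rr] x a y b.
have [tl tr] := ten_bilinear A E.
have comb (c : k) (p p' q q' r r' t t' : tens A E) :
    c *: p + p' + (c *: q + q') - (c *: r + r') - (c *: t + t') =
    c *: (p + q - r - t) + (p' + q' - r' - t').
  by rewrite !opprD !scalerDr !scalerN !addrA [LHS](ACl (1*3*5*7*2*4*6*8))%AC.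
rewrite /tensor_bracket tlift_ten; first rewrite tlift_ten //.
- split=> [v | u] c z z'; first by rewrite sr pr sl pl !tl comb.
  by rewrite rr lr rl ll !tr comb.
- split=> [v | u].
  + by apply: tlift_param => y' b' c u u'; rewrite pl sl pr sr !tl comb.
  + by apply: tlift_param => y' b' c v v'; rewrite ll rl lr rr !tr comb.
Qed.

Variables (A B : vectType k) (w : A -> A -> k^o).

Definition phi : 'Hom(A, dual A) := linfun (fun x => linfun (w x) : dual A).

(* g^* is the dual of g = A ⊗ B, so φ(y) ⊗ b^* enters through dtens_iso. *)
Definition double_iso :
    'Hom(tens A (dsum B (dual B)), dsum (tens A B) (dual (tens A B))) :=
  linfun (tlift (fun (x : A) (u : dsum B (dual B)) =>
    (ten x u.1, dtens_iso A B (ten (phi x) u.2))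
      : dsum (tens A B) (dual (tens A B)))).

Definition bracket_dual (prec succ : A -> A -> A)
    (dlS drS : dual B -> dual B -> dual B) :
    dual (tens A B) -> dual (tens A B) -> dual (tens A B) :=
  transport (dtens_iso A B)
    (tensor_bracket (transport phi prec) (transport phi succ) dlS drS).

Definition bracket_double (prec succ : A -> A -> A)
    (dld drd : dsum B (dual B) -> dsum B (dual B) -> dsum B (dual B)) :
    dsum (tens A B) (dual (tens A B)) -> dsum (tens A B) (dual (tens A B)) ->
    dsum (tens A B) (dual (tens A B)) :=
  transport double_iso (tensor_bracket prec succ dld drd).

End TensorBrackets.

(* Main.v *)
(* A dendriform algebra tensored with a diassociative algebra is a Lie algebra, the
   two operads being Koszul dual.  The bialgebra axioms say exactly that the
   double B + B^* is a diassociative algebra: paired with a fourth argument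
   through the invariant form, the five diassociative identities are permuted
   (up to linear combinations) by rotating the four arguments, so only the
   distributions BBBB, B*B*B*B*, BBBB*, B*B*B*B, BBB*B* and BB*BB* of the arguments
   among B and B^* matter; all but the last two follow from the identities in B
   and B^*, and those two are the axioms (1), (4)-(6) and (2), (3).
   The Lie Manin triple is then A tensored with the double, and
   B_s becomes omega tensored with omega_d, whence its invariance.  The
   cocycle condition is the Jacobi identity for x, y in g and a in g^*, paired
   with b in g^*. *)

Require Import Defs.
From mathcomp Require Import all_boot all_order all_algebra.
From mathcomp Require Import ring.

Set Implicit Arguments.
Unset Strict Implicit.
Unset Printing Implicit Defensive.

Import GRing.Theory.
Local Open Scope ring_scope.

(* [apply: (eq_comb h)] subtracts [h] from the goal, so a goal that is a linear
   combination of hypotheses is reduced to [ring]. *)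
Lemma eq_comb (V : zmodType) (x y l r : V) : l = r -> x + r = y + l -> x = y.
Proof. by move=> -> /addIr. Qed.

(** * Computation rules for bilinear maps *)

Section Bilinear.
Variables (k : fieldType) (U V W : vectType k) (f : U -> V -> W).
Hypothesis bf : bilinear_map f.

Lemma bilPl c u u' v : f (c *: u + u') v = c *: f u v + f u' v.
Proof. by have [fl _] := bf; exact: fl. Qed.

Lemma bilPr u c v v' : f u (c *: v + v') = c *: f u v + f u v'.
Proof. by have [_ fr] := bf; exact: fr. Qed.

Lemma bilDl u u' v : f (u + u') v = f u v + f u' v.
Proof. by rewrite -[u]scale1r bilPl !scale1r. Qed.

Lemma bilDr u v v' : f u (v + v') = f u v + f u v'.
Proof. by rewrite -[v]scale1r bilPr !scale1r. Qed.

Lemma bil0l v : f 0 v = 0.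
Proof. by apply: (addrI (f 0 v)); rewrite -bilDl !addr0. Qed.

Lemma bil0r u : f u 0 = 0.
Proof. by apply: (addrI (f u 0)); rewrite -bilDr !addr0. Qed.

Lemma bilZl c u v : f (c *: u) v = c *: f u v.
Proof. by rewrite -[c *: u]addr0 bilPl bil0l addr0. Qed.

Lemma bilZr u c v : f u (c *: v) = c *: f u v.
Proof. by rewrite -[c *: v]addr0 bilPr bil0r addr0. Qed.

Lemma bilNl u v : f (- u) v = - f u v.
Proof. by rewrite -scaleN1r bilZl scaleN1r. Qed.

Lemma bilNr u v : f u (- v) = - f u v.
Proof. by rewrite -scaleN1r bilZr scaleN1r. Qed.

End Bilinear.

(** * Maps out of tensor products and functionals on them *)

Section Tensors.
Variable k : fieldType.
Implicit Types U V W : vectType k.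

(** Extends [trsp] to maps between two spaces; for endomorphisms the two are convertible. *)
Definition pull V W (f : V -> W) (a : dual W) : dual V :=
  linfun (fun v => a (f v)).

Lemma pullE V W (f : V -> W) (a : dual W) v : linear f -> pull f a v = a (f v).
Proof. by move=> lf; rewrite linfunE // => c u u'; rewrite lf linearP. Qed.

(** This group restates general facts for functionals with the product of k in place of the scaling
    of [k^o], the form that [ring] understands. *)
Lemma lfun0 V (f : dual V) : f 0 = 0.
Proof. exact: linear0. Qed.

Lemma dual0 V (v : V) : (0 : dual V) v = 0.
Proof. exact: zero_lfunE. Qed.

Lemma lfunZ V (f : dual V) c u : f (c *: u) = c * f u.
Proof. exact: linearZ. Qed.

Lemma dualZ V c (f : dual V) u : (c *: f) u = c * f u.
Proof. exact: scale_lfunE. Qed.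

Lemma lfunD V (f : dual V) u v : f (u + v) = f u + f v.
Proof. exact: linearD. Qed.

Lemma lfunN V (f : dual V) u : f (- u) = - f u.
Proof. exact: linearN. Qed.

Lemma dualD V (f g : dual V) u : (f + g) u = f u + g u.
Proof. exact: add_lfunE. Qed.

Lemma dualN V (f : dual V) u : (- f) u = - f u.
Proof. exact: opp_lfunE. Qed.

Lemma pull_id V (a : dual V) : pull id a = a.
Proof. by apply/lfunP => v; rewrite pullE. Qed.

Lemma pullB V W (f g : V -> W) (a : dual W) : linear f -> linear g ->
  pull (fun v => f v - g v) a = pull f a - pull g a.
Proof.
move=> lf lg; apply/lfunP => v; rewrite add_lfunE opp_lfunE !pullE ?linearB //.
by move=> c u u'; rewrite lf lg scalerBr opprD addrACA.
Qed.

Lemma tmap_ten V W V' W' (f : V -> V') (g : W -> W') v w :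
  linear f -> linear g -> tmap f g (ten v w) = ten (f v) (g w).
Proof.
move=> lf lg; rewrite /tmap tlift_ten //; have [tl tr] := ten_bilinear V' W'.
by split=> [y c u u' | y c u u']; rewrite ?lf ?lg ?tl ?tr.
Qed.

Lemma tmap_linear V W V' W' (f : V -> V') (g : W -> W') : linear (tmap f g).
Proof. exact: tlift_linear. Qed.

Lemma tswap_ten V W (v : V) (w : W) : tswap (ten v w) = ten w v.
Proof.
rewrite /tswap tlift_ten //; have [tl tr] := ten_bilinear W V.
by split=> [y c u u' | y c u u']; rewrite ?tl ?tr.
Qed.

Lemma dten_tmap V W V' W' (f : V -> V') (g : W -> W') a b T :
  linear f -> linear g -> dten a b (tmap f g T) = dten (pull f a) (pull g b) T.
Proof.
move=> lf lg; move: T; apply: tens_ext => [c T T'|c T T'|v w].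
- by rewrite tmap_linear linearP.
- by rewrite linearP.
by rewrite tmap_ten // !dtenE !pullE.
Qed.

Lemma dten_tswap V W (a : dual V) (b : dual W) T :
  dten b a (tswap T) = dten a b T.
Proof.
move: T; apply: tens_ext => [c T T'|c T T'|v w].
- by rewrite [tswap _]tlift_linear linearP.
- by rewrite linearP.
by rewrite tswap_ten !dtenE mulrC.
Qed.

Lemma tassoc_ten U V W (u : U) (v : V) (w : W) :
  tassoc (ten (ten u v) w) = ten u (ten v w).
Proof.
have [ul ur] := ten_bilinear U (tens V W); have [tl tr] := ten_bilinear V W.
rewrite /tassoc tlift_ten; first rewrite tlift_ten //.
  by split=> [y c z z' | y c z z']; rewrite ?tl ?ul ?ur.
split=> [y c z z' | y c z z']; first by rewrite tlift_linear.
apply: (@tlift_param k (tens U (tens V W)) U V W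
  (fun w u v => ten u (ten v w))) => v' w' d s t.
by rewrite tr ur.
Qed.

Lemma dten_tassoc U V W (a : dual U) (b : dual V) (c : dual W) T :
  dten a (dten b c) (tassoc T) = dten (dten a b) c T.
Proof.
have asl : linear (@tassoc k U V W) by exact: tlift_linear.
move: T; apply: tens_ext => [d T T'|d T T'|S w].
- by rewrite asl linearP.
- by rewrite linearP.
have [tl _] := ten_bilinear (tens U V) W.
move: S; apply: tens_ext => [d S S'|d S S'|u v].
- by rewrite tl asl linearP.
- by rewrite tl linearP.
by rewrite tassoc_ten !dtenE mulrA.
Qed.

Lemma dten_ext V W (S T : tens V W) :
  (forall a b, dten a b S = dten a b T) -> S = T.
Proof.
have dE (i : 'I_(\dim {:V})) (j : 'I_(\dim {:W})) (R : tens V W) :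
    dten (bvec_dual i) (bvec_dual j) R = (R : 'M_(_,_)) i j.
  pose g (R : tens V W) : k^o := (R : 'M_(_,_)) i j.
  rewrite -[RHS]/(g R); move: R; apply: tens_ext => [c u v | c u v | v w].
  - by rewrite linearP.
  - by rewrite /g !mxE.
  by rewrite dtenE !linfunE ?/g ?mxE //; exact: bcrd_linear.
by move=> ST; apply/matrixP => i j; rewrite -!dE.
Qed.

(** The functionals [dten b c] span the dual of V ⊗ W: [dtens_iso] is injective between spaces of
    equal dimension, hence onto. *)
Lemma dten_ext3 U V W (S T : tens U (tens V W)) :
  (forall a b c, dten a (dten b c) S = dten a (dten b c) T) -> S = T.
Proof.
move=> ST; apply: dten_ext => a b; have [dl dr] := dten_bilinear U (tens V W).
suff H : (fun b => dten a b S) =1 fun b => dten a b T by exact: H.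
move=> {}b; have -> : b = dtens_iso V W ((dtens_iso V W)^-1%VF b).
  by rewrite lker0_dimK ?dtens_iso_inj // dim_dual !dim_tens !dim_dual.
move: (_ b); apply: tens_ext => [c u v|c u v|c d]; last by rewrite dtens_isoE.
- by rewrite linearP dr add_lfunE scale_lfunE.
- by rewrite linearP dr add_lfunE scale_lfunE.
Qed.

Lemma lker0_can U V (f : 'Hom(U, V)) (g : V -> U) : cancel f g -> lker f == 0%VS.
Proof. by move=> fK; apply/lker0P; exact: can_inj fK. Qed.

End Tensors.

(** * The Lie algebra A ⊗ E *)

Section TensorBracket.
Variables (k : fieldType) (A E : vectType k).
Variables (prec succ : A -> A -> A) (dl dr : E -> E -> E).

Lemma bcrdD (V : vectType k) i (u v : V) : bcrd i (u + v) = bcrd i u + bcrd i v.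
Proof. exact: linearD. Qed.

Lemma tensor_bracket_bilinear :
  bilinear_map prec -> bilinear_map succ -> bilinear_map dl -> bilinear_map dr ->
  bilinear_map (tensor_bracket prec succ dl dr).
Proof.
move=> [pl pr] [sl sr] [ll lr] [rl rr]; have [tl tr] := ten_bilinear A E.
split=> [Y|X] c Z Z'; first exact: tlift_linear.
apply: (@tlift_param k (tens A E) A E (tens A E)
  (fun Y x a => tlift (fun y b => ten (succ x y) (dr a b) +
    ten (prec x y) (dl a b) - ten (succ y x) (dr b a) -
    ten (prec y x) (dl b a)) Y)) => x a.
exact: tlift_linear.
Qed.

Hypotheses (HA : dendriform prec succ) (HE : diassociative dl dr).
Let br := tensor_bracket prec succ dl dr.

Let bp : bilinear_map prec. Proof. by case: HA. Qed.
Let bs : bilinear_map succ. Proof. by case: HA. Qed.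
Let bl : bilinear_map dl. Proof. by case: HE. Qed.
Let br' : bilinear_map dr. Proof. by case: HE. Qed.
Let brE : forall x a y b, br (ten x a) (ten y b) = _ :=
  tensor_bracket_ten bp bs bl br'.
Let bbr : bilinear_map br. Proof. exact: tensor_bracket_bilinear. Qed.

Lemma tensor_bracketC X Y : br X Y = - br Y X.
Proof.
have [bbl bbr'] := bbr.
move: X; apply: tens_ext => [||x a].
- exact: bbl.
- by move=> c u v; rewrite bbr' opprD scalerN.
move: Y; apply: tens_ext => [||y b].
- exact: bbr'.
- by move=> c u v; rewrite bbl opprD scalerN.
by rewrite !brE !opprD !opprK [RHS](ACl (3*4*1*2))%AC.
Qed.

Lemma tensor_bracket_jacobi X Y Z :
  br X (br Y Z) + br Y (br Z X) + br Z (br X Y) = 0.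
Proof.
have [bbl bbr'] := bbr.
have comb c (p p' q q' r r' : tens A E) :
   c *: p + p' + (c *: q + q') + (c *: r + r') =
   c *: (p + q + r) + (p' + q' + r').
  by rewrite !scalerDr !addrA [LHS](ACl (1*3*5*2*4*6))%AC.
have lin0 : linear (fun _ : tens A E => 0 : tens A E).
  by move=> c u v; rewrite scaler0 addr0.
move: X; apply: tens_ext (lin0) _ => [c u v|x a]; first by rewrite !(bbl, bbr') comb.
move: Y; apply: tens_ext (lin0) _ => [c u v|y b]; first by rewrite !(bbl, bbr') comb.
move: Z; apply: tens_ext (lin0) _ => [c u v|z e]; first by rewrite !(bbl, bbr') comb.
rewrite !brE !(bilDr bbr, bilNr bbr) !brE.
have [_ _ pp sp ss] := HA; have [_ _ ll llr rl rrl rr] := HE.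
have pp' u v w : prec (prec u v) w = prec u (prec v w) + prec u (succ v w).
  by rewrite pp /star (bilDr bp).
have ss' u v w : succ u (succ v w) = succ (prec u v) w + succ (succ u v) w.
  by rewrite -ss /star (bilDl bs).
(* Used as rewrite rules, the dendriform relations leave five shapes of triple products and the
   diassociative ones three; the tensors of these normal forms then cancel entrywise. *)
rewrite !(pp', sp, ss', ll, =^~ llr, rl, rrl, rr).
apply/matrixP => i j; rewrite !mxE !bcrdD.
ring.
Qed.

Lemma tensor_bracket_lie : [pchar k] =i pred0 -> lie_algebra br.
Proof.
move=> char0; split=> // [X|]; last exact: tensor_bracket_jacobi.
(* Antisymmetry only gives 2[X, X] = 0; characteristic 0 allows division by 2. *)
apply/eqP; have := tensor_bracketC X X; move/eqP; rewrite -addr_eq0 -mulr2n.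
by rewrite -scaler_nat scaler_eq0 ((pcharf0P k).1 char0).
Qed.

End TensorBracket.

(** Functoriality of the bracket in both factors; it will make the inclusions of g and of its dual
    into the double Lie morphisms. *)
Lemma tensor_bracket_morph (k : fieldType) (A A' E E' : vectType k)
    (prec succ : A -> A -> A) (dl dr : E -> E -> E)
    (prec' succ' : A' -> A' -> A') (dl' dr' : E' -> E' -> E')
    (g : A -> A') (h : E -> E') :
  bilinear_map prec -> bilinear_map succ -> bilinear_map dl -> bilinear_map dr ->
  bilinear_map prec' -> bilinear_map succ' ->
  bilinear_map dl' -> bilinear_map dr' -> linear g -> linear h ->
  {morph g : x y / prec x y >-> prec' x y} ->
  {morph g : x y / succ x y >-> succ' x y} ->
  {morph h : x y / dl x y >-> dl' x y} -> {morph h : x y / dr x y >-> dr' x y} ->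
  {morph tmap g h : X Y / tensor_bracket prec succ dl dr X Y >->
                          tensor_bracket prec' succ' dl' dr' X Y}.
Proof.
move=> bp bs bl br bp' bs' bl' br' lg lh gp gs hl hr X Y.
have [tl tr] := tensor_bracket_bilinear bp bs bl br.
have [tl' tr'] := tensor_bracket_bilinear bp' bs' bl' br'.
have lt := tmap_linear g h.
have tB (u v : tens A E) : tmap g h (u - v) = tmap g h u - tmap g h v.
  by rewrite -scaleN1r addrC lt scaleN1r addrC.
have tD (u v : tens A E) : tmap g h (u + v) = tmap g h u + tmap g h v.
  by rewrite -[u]scale1r lt !scale1r.
move: X; apply: tens_ext => [c u v|c u v|x a]; rewrite ?lt ?tl ?tl' ?lt //.
move: Y; apply: tens_ext => [c u v|c u v|y b]; rewrite ?lt ?tr ?tr' ?lt //.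
rewrite tmap_ten // tmap_ten // !tensor_bracket_ten // !tB tD !tmap_ten //.
by rewrite !gp !gs !hl !hr.
Qed.

(** * Diassociative identities under rotation by an invariant form *)

Section Anticyclic.
Variables (k : fieldType) (V : vectType k).
Variables (l r : V -> V -> V) (w : V -> V -> k).
Hypothesis wDr : forall X Y Z, w X (Y + Z) = w X Y + w X Z.
Hypothesis wC : forall X Y, w X Y = - w Y X.
(** Given antisymmetry, [rotl] and [rotr] are the two invariance conditions of a quadratic
    diassociative algebra, rewritten as rotations of the three arguments. *)
Hypothesis rotl : forall X Y Z, w (l Y Z) X = w (r X Y) Z - w (l X Y) Z.
Hypothesis rotr : forall X Y Z, w (r Y Z) X = - w (l X Y) Z.

Definition diass_against (X Y Z W : V) : Prop := [/\
  w (l (l X Y) Z) W = w (l X (l Y Z)) W,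
  w (l X (r Y Z)) W = w (l X (l Y Z)) W,
  w (l (r X Y) Z) W = w (r X (l Y Z)) W,
  w (r (r X Y) Z) W = w (r (l X Y) Z) W &
  w (r X (r Y Z)) W = w (r (l X Y) Z) W].

(* The relations of diassociative algebras span an anticyclic operadic ideal. *)
Lemma diass_against_rot X Y Z W : diass_against X Y Z W -> diass_against Y Z W X.
Proof.
have rotl' P S T : w P (l S T) = w (l P S) T - w (r P S) T.
  by rewrite wC rotl opprB.
have rotr' P S T : w P (r S T) = w (l P S) T by rewrite wC rotr opprK.
case=> ll llr rl rrl rr; rewrite /diass_against.
(* [rotl] and [rotr] bring X to the front, [rotl'] and [rotr'] then free W, so that every term
   becomes a triple product of X, Y, Z against W, where the given identities apply. *)
by split; rewrite !(rotl X, rotr X) ?(rotl', rotr') ?(ll, llr, rl, rrl, rr); ring.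
Qed.

Lemma diass_againstD X Y Z W W' :
  diass_against X Y Z W -> diass_against X Y Z W' -> diass_against X Y Z (W + W').
Proof.
case=> ll llr rl rrl rr [ll' llr' rl' rrl' rr'].
by split; rewrite !wDr ?(ll, llr, rl, rrl, rr, ll', llr', rl', rrl', rr').
Qed.

(* Up to rotation there are six ways to distribute four arguments among U0 and U1. *)
Lemma diass_against_split (U0 U1 : V -> Prop) :
  (forall X, exists X0 X1, [/\ U0 X0, U1 X1 & X = X0 + X1]) ->
  (forall X Y Z, U0 X -> U0 Y -> U0 Z -> forall W, diass_against X Y Z W) ->
  (forall X Y Z, U1 X -> U1 Y -> U1 Z -> forall W, diass_against X Y Z W) ->
  (forall X Y Z W, U0 X -> U0 Y -> U1 Z -> U1 W -> diass_against X Y Z W) ->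
  (forall X Y Z W, U0 X -> U1 Y -> U0 Z -> U1 W -> diass_against X Y Z W) ->
  forall X Y Z W, diass_against X Y Z W.
Proof.
move=> split Q0 Q1 Q2 Q3 X Y Z W.
have rot2 X' Y' Z' W' (Q : diass_against X' Y' Z' W') : diass_against Z' W' X' Y'.
  by do 2 apply: diass_against_rot.
have rot3 X' Y' Z' W' (Q : diass_against X' Y' Z' W') : diass_against W' X' Y' Z'.
  by do 3 apply: diass_against_rot.
have [X0 [X1 [HX0 HX1 ->]]] := split X; have [Y0 [Y1 [HY0 HY1 ->]]] := split Y.
have [Z0 [Z1 [HZ0 HZ1 ->]]] := split Z; have [W0 [W1 [HW0 HW1 ->]]] := split W.
(* Additivity is available in the last argument only, so each splitting is followed by a rotation.
   Four rounds restore the order and leave sixteen pure cases, each at most three rotations away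
   from a hypothesis. *)
by apply: diass_againstD; apply: diass_against_rot;
  apply: diass_againstD; apply: diass_against_rot;
  apply: diass_againstD; apply: diass_against_rot;
  apply: diass_againstD; apply: diass_against_rot;
  first [ exact: Q0 | exact: Q1 | exact: Q2 | exact: Q3
  | by apply: diass_against_rot; first [exact: Q0|exact: Q1|exact: Q2|exact: Q3]
  | by apply: rot2; first [exact: Q0|exact: Q1|exact: Q2|exact: Q3]
  | by apply: rot3; first [exact: Q0|exact: Q1|exact: Q2|exact: Q3]].
Qed.

End Anticyclic.

(** * The form ω_d, here [dsum_form], and the double operations on V ⊕ V^* *)

Definition dsum_form (k : fieldType) (V : vectType k) (X Y : dsum V (dual V)) : k :=
  X.2 Y.1 - Y.2 X.1.

Section Manin.
Variables (k : fieldType) (V : vectType k).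
Implicit Types (x y z : V) (a b e f : dual V) (X Y Z W : dsum V (dual V)).

Let w : dsum V (dual V) -> dsum V (dual V) -> k := @dsum_form k V.

Lemma dsum_formC X Y : w X Y = - w Y X.
Proof. by rewrite /w /dsum_form opprB. Qed.

Lemma dsum_formPl c X X' Y : w (c *: X + X') Y = c * w X Y + w X' Y.
Proof. by rewrite /w /dsum_form /= lfunD lfunZ dualD dualZ; ring. Qed.

Lemma dsum_formDr X Y Y' : w X (Y + Y') = w X Y + w X Y'.
Proof. by rewrite /w /dsum_form /= lfunD dualD; ring. Qed.

Lemma eq_dual_val x y : (forall a, a x = a y) -> x = y.
Proof.
move=> xy; apply: (lker0P (bidual_inj V)); apply/lfunP => a.
by rewrite !bidualE xy.
Qed.

(** Nondegeneracy of ω_d, which allows identities in the double to be proved after pairing. *)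
Lemma dsum_form_ext X Y : (forall Z, w X Z = w Y Z) -> X = Y.
Proof.
case: X Y => [x a] [y b] XY; congr pair.
  apply: eq_dual_val => e; have := XY (0, e).
  by rewrite /w /dsum_form /= !linear0 !sub0r => /oppr_inj.
apply/lfunP => z; have := XY (z, 0).
by rewrite /w /dsum_form /= !zero_lfunE !subr0.
Qed.

Lemma Lmul_linear (U : vectType k) (op : U -> U -> U) u :
  bilinear_map op -> linear (Lmul op u).
Proof. by move=> [_ opr]; exact: opr. Qed.

Lemma Rmul_linear (U : vectType k) (op : U -> U -> U) u :
  bilinear_map op -> linear (Rmul op u).
Proof. by move=> [opl _]; exact: opl. Qed.

Lemma bul_bilinear (U : vectType k) (op op' : U -> U -> U) :
  bilinear_map op -> bilinear_map op' -> bilinear_map (bul op op').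
Proof.
move=> b b'; split=> [v c u u'|u c v v']; rewrite /bul.
  by rewrite !(bilPl b, bilPl b') scalerBr opprD addrACA.
by rewrite !(bilPr b, bilPr b') scalerBr opprD addrACA.
Qed.

#[local] Hint Resolve Lmul_linear Rmul_linear bul_bilinear : core.

Variables (dl dr : V -> V -> V) (dlS drS : dual V -> dual V -> dual V).
Hypotheses (bl : bilinear_map dl) (br : bilinear_map dr).
Hypotheses (blS : bilinear_map dlS) (brS : bilinear_map drS).

Let ml := manin_l dl dr dlS drS.
Let mr := manin_r dl dr dlS drS.

(** Under the pairing every transpose becomes an evaluation, so that bilinearity and invariance of
    the double operations are left to [ring]. *)
Lemma manin_lE X Y Z : w (ml X Y) Z =
  dlS X.2 Y.2 Z.1 - Y.2 (dr Z.1 X.1 - dl Z.1 X.1) + X.2 (dr Y.1 Z.1)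
  - (Z.2 (dl X.1 Y.1) + drS Y.2 Z.2 X.1
     - (drS Z.2 X.2 Y.1 - dlS Z.2 X.2 Y.1)).
Proof.
case: X Y Z => [x a] [y b] [z e].
rewrite /w /dsum_form /ml /= !(dualD, dualN, lfunD, lfunN) !trsp_preE; auto.
rewrite -!/(pull (Rmul _ _) _) -!/(pull (Lmul _ _) _) !pullE; auto.
rewrite /Lmul /Rmul /bul !(dualD, dualN, lfunD, lfunN); ring.
Qed.

Lemma manin_rE X Y Z : w (mr X Y) Z =
  drS X.2 Y.2 Z.1 + Y.2 (dl Z.1 X.1) + X.2 (dr Y.1 Z.1 - dl Y.1 Z.1)
  - (Z.2 (dr X.1 Y.1) + (drS Y.2 Z.2 X.1 - dlS Y.2 Z.2 X.1) + dlS Z.2 X.2 Y.1).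
Proof.
case: X Y Z => [x a] [y b] [z e].
rewrite /w /dsum_form /mr /= !(dualD, dualN, lfunD, lfunN) !trsp_preE; auto.
rewrite -!/(pull (Rmul _ _) _) -!/(pull (Lmul _ _) _) !pullE; auto.
rewrite /Lmul /Rmul /bul !(dualD, dualN, lfunD, lfunN); ring.
Qed.

(** Invariance of ω_d already holds for arbitrary bilinear operations on V and V^*; the bialgebra
    axioms enter only in the diassociative identities. *)
Lemma manin_rotl X Y Z : w (ml Y Z) X = w (mr X Y) Z - w (ml X Y) Z.
Proof. rewrite !(manin_lE, manin_rE) !(lfunD, lfunN); ring. Qed.

Lemma manin_rotr X Y Z : w (mr Y Z) X = - w (ml X Y) Z.
Proof. rewrite !(manin_lE, manin_rE) !(lfunD, lfunN); ring. Qed.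

Let bilP := (bilPl bl, bilPl br, bilPl blS, bilPl brS,
             bilPr bl, bilPr br, bilPr blS, bilPr brS).

Lemma manin_l_bilinear : bilinear_map ml.
Proof.
split=> [Y c X X'|Y c X X']; apply: dsum_form_ext => Z;
  rewrite dsum_formPl !manin_lE /= !bilP !(lfunD, lfunN, lfunZ, dualD, dualZ);
  ring.
Qed.

Lemma manin_r_bilinear : bilinear_map mr.
Proof.
split=> [Y c X X'|Y c X X']; apply: dsum_form_ext => Z;
  rewrite dsum_formPl !manin_rE /= !bilP !(lfunD, lfunN, lfunZ, dualD, dualZ);
  ring.
Qed.

Let bil0 := (bil0l bl, bil0l br, bil0l blS, bil0l brS,
             bil0r bl, bil0r br, bil0r blS, bil0r brS).

Let simp0 := (bil0, lfun0, dual0, subr0, sub0r, add0r, addr0, oppr0).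

Lemma manin_l_incl x y : ml (x, 0) (y, 0) = (dl x y, 0).
Proof.
by apply: dsum_form_ext => Z; rewrite manin_lE /w /dsum_form /= !simp0.
Qed.

Lemma manin_r_incl x y : mr (x, 0) (y, 0) = (dr x y, 0).
Proof.
by apply: dsum_form_ext => Z; rewrite manin_rE /w /dsum_form /= !simp0.
Qed.

Lemma manin_l_inclS a b : ml (0, a) (0, b) = (0, dlS a b).
Proof.
by apply: dsum_form_ext => Z; rewrite manin_lE /w /dsum_form /= !simp0.
Qed.

Lemma manin_r_inclS a b : mr (0, a) (0, b) = (0, drS a b).
Proof.
by apply: dsum_form_ext => Z; rewrite manin_rE /w /dsum_form /= !simp0.
Qed.

Lemma dsum_form1 X f : f X.1 = - w X (0, f).
Proof. by rewrite /w /dsum_form /= lfun0 sub0r opprK. Qed.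

Lemma dsum_form2 X z : X.2 z = w X (z, 0).
Proof. by rewrite /w /dsum_form /= dual0 subr0. Qed.

Let bl_l x : linear (dl x). Proof. by have [_ H] := bl; exact: H. Qed.
Let br_l x : linear (dr x). Proof. by have [_ H] := br; exact: H. Qed.
Let bl_r x : linear (dl^~ x). Proof. by have [H _] := bl; exact: H. Qed.
Let br_r x : linear (dr^~ x). Proof. by have [H _] := br; exact: H. Qed.

(** Components of the mixed products: in these names V and S, for V^*, tell where the two factors
    lie, and the digit is the component. Component 1 is read against a functional f. *)
Lemma manin_l_VS2 x a :
  (ml (x, 0) (0, a)).2 = pull (dl^~ x) a - pull (dr^~ x) a.
Proof.
apply/lfunP => z; rewrite dsum_form2 manin_lE /= dualD dualN !pullE //.
by rewrite !simp0 lfunD lfunN opprB.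
Qed.

Lemma manin_l_VS1 x a f : f (ml (x, 0) (0, a)).1 = drS a f x.
Proof. rewrite dsum_form1 manin_lE /= !simp0; ring. Qed.

Lemma manin_l_SV2 x a : (ml (0, a) (x, 0)).2 = pull (dr x) a.
Proof.
by apply/lfunP => z; rewrite dsum_form2 manin_lE /= pullE // !simp0.
Qed.

Lemma manin_l_SV1 x a f : f (ml (0, a) (x, 0)).1 = dlS f a x - drS f a x.
Proof. rewrite dsum_form1 manin_lE /= !simp0; ring. Qed.

Lemma manin_r_VS2 x a : (mr (x, 0) (0, a)).2 = pull (dl^~ x) a.
Proof.
by apply/lfunP => z; rewrite dsum_form2 manin_rE /= pullE // !simp0.
Qed.

Lemma manin_r_VS1 x a f : f (mr (x, 0) (0, a)).1 = drS a f x - dlS a f x.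
Proof. rewrite dsum_form1 manin_rE /= !simp0; ring. Qed.

Lemma manin_r_SV2 x a : (mr (0, a) (x, 0)).2 = pull (dr x) a - pull (dl x) a.
Proof.
apply/lfunP => z; rewrite dsum_form2 manin_rE /= dualD dualN !pullE //.
by rewrite !simp0 lfunD lfunN.
Qed.

Lemma manin_r_SV1 x a f : f (mr (0, a) (x, 0)).1 = dlS f a x.
Proof. rewrite dsum_form1 manin_rE /= !simp0; ring. Qed.

End Manin.

(** * The diassociative algebra dual to a coalgebra *)

Section DualOperations.
Variables (k : fieldType) (V : vectType k).
Implicit Types (D Dl Dr : V -> tens V V) (a b c : dual V).

Lemma op_of_coopE D a b x : linear D -> op_of_coop D a b x = dten a b (D x).
Proof. by move=> lD; rewrite op_of_coopP. Qed.

Lemma op_of_coop_bilinear D : linear D -> bilinear_map (op_of_coop D).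
Proof.
move=> lD; have [dl dr] := dten_bilinear V V.
by split=> [b c a a'|a c b b']; apply/lfunP => x;
  rewrite add_lfunE scale_lfunE !op_of_coopE // ?dl ?dr add_lfunE scale_lfunE.
Qed.

Lemma dten_coop_l D D' a b c x : linear D -> linear D' ->
  dten a (dten b c) (tassoc (tmap D' id (D x))) =
  op_of_coop D (op_of_coop D' a b) c x.
Proof. by move=> lD lD'; rewrite dten_tassoc dten_tmap // pull_id op_of_coopE. Qed.

Lemma dten_coop_r D D' a b c x : linear D -> linear D' ->
  dten a (dten b c) (tmap id D' (D x)) =
  op_of_coop D a (op_of_coop D' b c) x.
Proof. by move=> lD lD'; rewrite dten_tmap // pull_id op_of_coopE. Qed.

(** Each coalgebra axiom, paired with a ⊗ (b ⊗ c), becomes a diassociative identity on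
    functionals. *)
Lemma diassociative_dual Dl Dr :
  diass_coalgebra Dl Dr -> diassociative (op_of_coop Dl) (op_of_coop Dr).
Proof.
case=> lDl lDr ll_r ll rl rr_l rr.
split; try exact: op_of_coop_bilinear; move=> a b c; apply/lfunP => x.
- by rewrite -dten_coop_l // -dten_coop_r // ll_r -ll.
- by rewrite -!dten_coop_r // ll_r.
- by rewrite -dten_coop_l // -dten_coop_r // rl.
- by rewrite -!dten_coop_l // rr_l.
- by rewrite -dten_coop_l // -dten_coop_r // rr_l rr.
Qed.

End DualOperations.

(** * The double of a diassociative bialgebra *)

Section DoubleDiassociative.
Variables (k : fieldType) (B : vectType k).
Variables (dl dr : B -> B -> B) (Dl Dr : B -> tens B B).
Implicit Types (x y p q : B) (a b : dual B) (U : dsum B (dual B)).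
Hypothesis HB : diass_bialgebra dl dr Dl Dr.

Let dlS := op_of_coop Dl.
Let drS := op_of_coop Dr.
Local Notation ml := (manin_l dl dr dlS drS).
Local Notation mr := (manin_r dl dr dlS drS).
Let w : dsum B (dual B) -> dsum B (dual B) -> k := @dsum_form k B.

Let HBalg : diassociative dl dr. Proof. by case: HB. Qed.
Let HBco : diass_coalgebra Dl Dr. Proof. by case: HB. Qed.
Let HS : diassociative dlS drS. Proof. exact: diassociative_dual. Qed.
Let bl : bilinear_map dl. Proof. by case: HBalg. Qed.
Let br : bilinear_map dr. Proof. by case: HBalg. Qed.
Let blS : bilinear_map dlS. Proof. by case: HS. Qed.
Let brS : bilinear_map drS. Proof. by case: HS. Qed.
Let lDl : linear Dl. Proof. by case: HBco. Qed.
Let lDr : linear Dr. Proof. by case: HBco. Qed.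

Let dlSE a b x : dten a b (Dl x) = dlS a b x. Proof. by rewrite -op_of_coopE. Qed.
Let drSE a b x : dten a b (Dr x) = drS a b x. Proof. by rewrite -op_of_coopE. Qed.

Let pullLl x a : pull (Lmul dl x) a = pull (dl x) a. Proof. by []. Qed.
Let pullLr x a : pull (Lmul dr x) a = pull (dr x) a. Proof. by []. Qed.
Let pullRl x a : pull (Rmul dl x) a = pull (dl^~ x) a. Proof. by []. Qed.
Let pullRr x a : pull (Rmul dr x) a = pull (dr^~ x) a. Proof. by []. Qed.
Let pullLb x a : pull (Lmul (bul dl dr) x) a = pull (dr x) a - pull (dl x) a.
Proof. by apply: pullB; [have [_ H] := br | have [_ H] := bl]; exact: H. Qed.
Let pullRb x a : pull (Rmul (bul dl dr) x) a = pull (dr^~ x) a - pull (dl^~ x) a.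
Proof. by apply: pullB; [have [H _] := br | have [H _] := bl]; exact: H. Qed.
Let pullE' := (pullLl, pullLr, pullRl, pullRr, pullLb, pullRb, @pull_id k B).

Let bilS := (bilDl blS, bilDr blS, bilNl blS, bilNr blS,
             bilDl brS, bilDr brS, bilNl brS, bilNr brS).

#[local] Hint Resolve Lmul_linear Rmul_linear bul_bilinear : core.

(* Read an identity of tensors in B ⊗ B against a ⊗ b. *)
Ltac pair_with a b H := have := congr1 (dten a b) H;
  rewrite /Dbul !(lfunD, lfunN) ?dten_tswap !dten_tmap //; auto;
  rewrite ?(lfunD, lfunN) !(dlSE, drSE) !pullE' ?bilS ?(dualD, dualN).

Let ml_incl := manin_l_incl bl br blS brS.
Let mr_incl := manin_r_incl bl br blS brS.
Let ml_inclS := manin_l_inclS bl br blS brS.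
Let mr_inclS := manin_r_inclS bl br blS brS.

Let mixedE :=
  (manin_l_VS1 bl br blS brS, manin_l_VS2 bl br blS brS,
   manin_l_SV1 bl br blS brS, manin_l_SV2 bl br blS brS,
   manin_r_VS1 bl br blS brS, manin_r_VS2 bl br blS brS,
   manin_r_SV1 bl br blS brS, manin_r_SV2 bl br blS brS).
Let zeroE := (bil0l bl, bil0r bl, bil0l br, bil0r br,
  bil0l blS, bil0r blS, bil0l brS, bil0r brS, subr0, lfun0, dual0).

Let dlE x a y : a (dl x y) = pull (dl x) a y.
Proof. by rewrite pullE //; have [_ H] := bl; exact: H. Qed.
Let drE x a y : a (dr x y) = pull (dr x) a y.
Proof. by rewrite pullE //; have [_ H] := br; exact: H. Qed.
Let dlE' x a y : a (dl x y) = pull (dl^~ y) a x.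
Proof. by rewrite pullE //; have [H _] := bl; exact: H. Qed.
Let drE' x a y : a (dr x y) = pull (dr^~ y) a x.
Proof. by rewrite pullE //; have [H _] := br; exact: H. Qed.

(** [U] is kept arbitrary in this and the next three facts because it will be an inner mixed
    product, whose components [mixedE] supplies. *)
Let ml_VU p b U : w (ml (p, 0) U) (0, b) = - (pull (dl p) b U.1 + drS U.2 b p).
Proof. rewrite /w manin_lE //= !zeroE dlE; ring. Qed.
Let mr_VU p b U : w (mr (p, 0) U) (0, b) =
  - (pull (dr p) b U.1 + (drS U.2 b p - dlS U.2 b p)).
Proof. rewrite /w manin_rE //= !zeroE drE; ring. Qed.
Let ml_UV p b U : w (ml U (p, 0)) (0, b) =
  - (pull (dl^~ p) b U.1 - (drS b U.2 p - dlS b U.2 p)).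
Proof. rewrite /w manin_lE //= !zeroE dlE'; ring. Qed.
Let mr_UV p b U : w (mr U (p, 0)) (0, b) = - (pull (dr^~ p) b U.1 + dlS b U.2 p).
Proof. rewrite /w manin_rE //= !zeroE drE'; ring. Qed.

(* S stands for the dual B^*. *)
Lemma double_BBSS p q a b :
  diass_against ml mr w (p, 0) (q, 0) (0, a) (0, b).
Proof.
pair_with a b (dibi_1a HB p q) => h1a.
pair_with a b (dibi_1b HB p q) => h1b.
pair_with a b (dibi_4a HB p q) => h4a.
pair_with a b (dibi_5 HB p q) => h5.
pair_with a b (dibi_6 HB p q) => h6.
split; rewrite ?ml_incl ?mr_incl !(ml_VU, mr_VU) ?mixedE
  ?bilS ?(dualD, dualN) /= ?zeroE.
- rewrite h1a; ring.
(* The product of p and q does not occur in this identity: it compares the two expressions that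
   [dibi_1a] and [dibi_1b] give for the same coproduct. *)
- apply: (eq_comb h1b); apply: (eq_comb (esym h1a)); ring.
- rewrite h6; ring.
- rewrite h6 h4a h1b h5; ring.
- rewrite h1b h5; ring.
Qed.

Lemma double_BSBS p q a b :
  diass_against ml mr w (p, 0) (0, a) (q, 0) (0, b).
Proof.
pair_with b a (dibi_2a HB p q) => h2a.
pair_with b a (dibi_2b HB p q) => h2b.
pair_with b a (dibi_3a HB p q) => h3a.
pair_with b a (dibi_3b HB p q) => h3b.
(* The half-turn of p, a, q, b exchanges p with q and a with b; the third identity needs this copy
   of the axiom as well. *)
pair_with a b (dibi_2b HB q p) => h2b_swap.
split; rewrite !(ml_VU, mr_VU, ml_UV, mr_UV) ?mixedE ?bilS ?(dualD, dualN).
- apply: (eq_comb h2a); apply: (eq_comb h2b); ring.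
- apply: (eq_comb h2a); ring.
- apply: (eq_comb h2a); apply: (eq_comb (esym h3b)).
  by apply: (eq_comb (esym h2b_swap)); ring.
- apply: (eq_comb h3a); ring.
- apply: (eq_comb h3a); apply: (eq_comb h3b); ring.
Qed.

Lemma double_diassociative : diassociative ml mr.
Proof.
pose U0 (X : dsum B (dual B)) := X.2 = 0.
pose U1 (X : dsum B (dual B)) := X.1 = 0.
suff Q : forall X Y Z W, diass_against ml mr w X Y Z W.
  split; [exact: manin_l_bilinear|exact: manin_r_bilinear| | | | |];
  by move=> X Y Z; apply: dsum_form_ext => W; case: (Q X Y Z W).
apply: (diass_against_split _ _ _ _ (U0 := U0) (U1 := U1)).
- exact: dsum_formDr.
- exact: dsum_formC.
- exact: manin_rotl.
- exact: manin_rotr.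
- case=> x a; exists (x, 0), (0, a); split=> //.
  by congr pair; rewrite ?addr0 ?add0r.
(* With three arguments in B all products stay in B, whatever the fourth argument; the next case is
   the same in B^*. *)
- move=> [x a] [y b] [z c]; rewrite /U0 /U1 /= => -> -> -> W.
  have [_ _ ll llr rl rrl rr] := HBalg.
  by split; rewrite !(ml_incl, mr_incl) ?(ll, llr, rl, rrl, rr).
- move=> [x a] [y b] [z c]; rewrite /U0 /U1 /= => -> -> -> W.
  have [_ _ ll llr rl rrl rr] := HS.
  by split; rewrite !(ml_inclS, mr_inclS) ?(ll, llr, rl, rrl, rr).
- move=> [x a] [y b] [z c] [t e]; rewrite /U0 /U1 /= => -> -> -> ->.
  exact: double_BBSS.
- move=> [x a] [y b] [z c] [t e]; rewrite /U0 /U1 /= => -> -> -> ->.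
  exact: double_BSBS.
Qed.

End DoubleDiassociative.

(** * From a Manin triple of Lie algebras to a Lie bialgebra *)

Lemma lie_anticomm (k : fieldType) (g : vectType k) (br : g -> g -> g) x y :
  lie_algebra br -> br x y = - br y x.
Proof.
case=> bbr alt _; apply/eqP; rewrite -addr_eq0; apply/eqP.
have := alt (x + y).
by rewrite (bilDl bbr) !(bilDr bbr) !alt addr0 add0r.
Qed.

Section Bialgebra.
Variables (k : fieldType) (g : vectType k).
Implicit Types (X Y Z : dsum g (dual g)) (x y : g) (a b e : dual g).

Lemma BsDl X X' Y : Bs (X + X') Y = Bs X Y + Bs X' Y.
Proof. rewrite /Bs /= lfunD dualD; ring. Qed.

Lemma BsDr X Y Y' : Bs X (Y + Y') = Bs X Y + Bs X Y'.
Proof. rewrite /Bs /= lfunD dualD; ring. Qed.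

Lemma BsPl c X X' Y : Bs (c *: X + X') Y = c * Bs X Y + Bs X' Y.
Proof. rewrite /Bs /= lfunD lfunZ dualD dualZ; ring. Qed.

Lemma BsPr c X Y Y' : Bs X (c *: Y + Y') = c * Bs X Y + Bs X Y'.
Proof. rewrite /Bs /= lfunD lfunZ dualD dualZ; ring. Qed.

Lemma BsNl X Y : Bs (- X) Y = - Bs X Y.
Proof. rewrite /Bs /= lfunN dualN; ring. Qed.

Lemma BsNr X Y : Bs X (- Y) = - Bs X Y.
Proof. rewrite /Bs /= lfunN dualN; ring. Qed.

Variables (brd : dsum g (dual g) -> dsum g (dual g) -> dsum g (dual g)).
Variables (br : g -> g -> g) (brS : dual g -> dual g -> dual g).
Hypothesis H : lie_manin_triple brd br brS.

Let Hd : lie_algebra brd. Proof. by case: H. Qed.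
Let Hg : lie_algebra br. Proof. by case: H. Qed.
Let HgS : lie_algebra brS. Proof. by case: H. Qed.
Let bbr : bilinear_map br. Proof. by case: Hg. Qed.

Let D := coop_of_op brS.
Let DE a b x : dten a b (D x) = brS a b x.
Proof. by apply: coop_of_opP; case: HgS. Qed.

Lemma coop_linear : linear D.
Proof.
move=> c x y; apply: dten_ext => a b.
by rewrite lfunD lfunZ !DE lfunD lfunZ.
Qed.

(** Read against functionals, the coalgebra axioms are antisymmetry and the Jacobi identity of
    [brS]; there [tcycle] rotates the three functionals. *)
Lemma manin_lie_coalgebra : lie_coalgebra D.
Proof.
split=> [|x|x T]; first exact: coop_linear.
  apply: dten_ext => a b.
  by rewrite lfunN dten_tswap !DE (lie_anticomm _ _ HgS) dualN.
have TE a b e : dten a (dten b e) T = brS a (brS b e) x.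
  rewrite dten_tmap ?pull_id ?DE //; last exact: coop_linear.
  congr (brS _ _ _); apply/lfunP => y.
  by rewrite pullE ?DE //; exact: coop_linear.
have cE S a b e : dten a (dten b e) (tcycle S) = dten e (dten a b) S.
  by rewrite /tcycle dten_tassoc dten_tswap.
apply: dten_ext3 => a b e; rewrite !lfunD !cE !TE lfun0 -!dualD.
have [_ _ jac] := HgS; have := jac a b e.
by rewrite addrAC => ->; rewrite dual0.
Qed.

Let br_l x : linear (br x). Proof. by have [_ R] := bbr; exact: R. Qed.

(** Invariance forces the mixed brackets to be coadjoint actions: pairing with g^* determines the
    component in g, and pairing with g, in the next lemma, the other one. *)
Lemma manin_cross1 a e x : e (brd (0, a) (x, 0)).1 = - brS a e x.
Proof.
have [_ _ _ _ subS inv] := H.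
have -> : e (brd (0, a) (x, 0)).1 = Bs (brd (0, a) (x, 0)) (0, e).
  by rewrite /Bs /= lfun0 addr0.
by rewrite (lie_anticomm _ _ Hd) BsNl inv subS /Bs /= dual0 addr0.
Qed.

Lemma manin_cross2 a x : (brd (0, a) (x, 0)).2 = pull (br x) a.
Proof.
have [_ _ _ sub _ inv] := H; apply/lfunP => y; rewrite pullE //.
have -> : (brd (0, a) (x, 0)).2 y = Bs (brd (0, a) (x, 0)) (y, 0).
  by rewrite /Bs /= dual0 add0r.
by rewrite inv sub /Bs /= dual0 add0r.
Qed.

Lemma Bs_cross a b x y : Bs (brd (0, a) (y, 0)) (brd (0, b) (x, 0)) =
  - brS a (pull (br x) b) y - brS b (pull (br y) a) x.
Proof. by rewrite /Bs !manin_cross2 !manin_cross1. Qed.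

Lemma manin_cocycle x y : D (br x y) =
  (tmap (br x) id (D y) + tmap id (br x) (D y))
    - (tmap (br y) id (D x) + tmap id (br y) (D x)).
Proof.
have [_ _ jac] := Hd; have [_ _ _ sub subS inv] := H.
have anti X Y := lie_anticomm X Y Hd.
have flip X U Z : Bs (brd X U) Z = - Bs U (brd X Z) by rewrite anti BsNl inv.
apply: dten_ext => a b; rewrite !(lfunD, lfunN) !dten_tmap // !pull_id !DE.
have := congr1 (fun Z => Bs Z (0, b)) (jac (x, 0) (y, 0) (0, a)).
(* [flip] says that ad X is skew for [Bs]. It turns each nested bracket of the Jacobi identity into
   a pairing of two simple brackets: two mixed pairs, given by [Bs_cross], and the pair of [x, y]
   with [a, b]. *)
rewrite /= !BsDl !(flip _ (brd _ _)) (anti (y, 0) (0, a)) (anti (x, 0) (0, b)).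
rewrite (anti (y, 0) (0, b)) !(BsNl, BsNr) !Bs_cross sub subS.
rewrite (lie_anticomm b _ HgS) (lie_anticomm b (pull (br x) a) HgS) !dualN.
rewrite /Bs /= !dual0 !lfun0 !addr0 => E; apply: (eq_comb (esym E)); ring.
Qed.

Lemma manin_lie_bialgebra : lie_bialgebra br D.
Proof.
by split; [exact: Hg|exact: manin_lie_coalgebra|exact: manin_cocycle].
Qed.

End Bialgebra.

(** * Transport of algebra structures along a linear isomorphism *)

Section Transport.
Variables (k : fieldType) (U V : vectType k) (f : 'Hom(U, V)).
Hypotheses (fK : cancel f f^-1%VF) (fVK : cancel f^-1%VF f).
Implicit Types op prec succ br : U -> U -> U.

Lemma transport_bilinear op : bilinear_map op -> bilinear_map (transport f op).
Proof.
move=> bop; split=> [Y|X] c Z Z'; rewrite /transport linearP.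
  by rewrite (bilPl bop) linearP.
by rewrite (bilPr bop) linearP.
Qed.

Lemma transport_invE op :
  {morph f^-1%VF : X Y / transport f op X Y >-> op X Y}.
Proof. by move=> X Y; rewrite /transport fK. Qed.

Lemma transport_dendriform prec succ : dendriform prec succ ->
  dendriform (transport f prec) (transport f succ).
Proof.
case=> bp bs pp sp ss; split; try exact: transport_bilinear.
- by move=> x y z; rewrite /star /transport -linearD !fK pp.
- by move=> x y z; rewrite /transport !fK sp.
- by move=> x y z; rewrite /star /transport -linearD !fK ss.
Qed.

Lemma transport_lie br : lie_algebra br -> lie_algebra (transport f br).
Proof.
case=> bbr alt jac; split=> [|X|X Y Z]; first exact: transport_bilinear.
  by rewrite /transport alt linear0.
by rewrite /transport !fK -!linearD jac linear0.
Qed.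

End Transport.

(** * The Lie Manin triple on g ⊕ g^* *)

Section TensorManinTriple.
Variables (k : fieldType) (A B : vectType k).
Variables (prec succ : A -> A -> A) (omega : A -> A -> k^o).
Hypothesis HA : quadratic_dendriform prec succ omega.

Let HAd : dendriform prec succ. Proof. by case: HA. Qed.
Let bp : bilinear_map prec. Proof. by case: HAd. Qed.
Let bs : bilinear_map succ. Proof. by case: HAd. Qed.

Local Notation phi := (phi omega).

Lemma phiE x y : phi x y = omega x y.
Proof.
have [_ [ol or] _ _ _ _] := HA.
rewrite /Defs.phi linfunE; first by rewrite linfunE.
move=> c u v; apply/lfunP => z.
by rewrite add_lfunE scale_lfunE !linfunE // ol.
Qed.

Lemma phiK : cancel phi phi^-1%VF.
Proof.
have [_ _ nd _ _ _] := HA; apply: lker0_lfunK; apply/lker0P => x y xy.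
apply: subr0_eq; apply: nd => z.
by rewrite -phiE linearB /= xy subrr zero_lfunE.
Qed.

Lemma phiVK : cancel phi^-1%VF phi.
Proof. by apply: lker0_dimK; [rewrite dim_dual|exact: lker0_can phiK]. Qed.

Lemma dtens_isoK (V W : vectType k) : cancel (dtens_iso V W) (dtens_iso V W)^-1%VF.
Proof. by apply: lker0_lfunK; exact: dtens_iso_inj. Qed.

Lemma dtens_isoVK (V W : vectType k) : cancel (dtens_iso V W)^-1%VF (dtens_iso V W).
Proof.
by apply: lker0_dimK; [rewrite dim_dual !dim_tens !dim_dual|exact: dtens_iso_inj].
Qed.

Let inB (b : B) : dsum B (dual B) := (b, 0).
Let inS (b : dual B) : dsum B (dual B) := (0, b).

Let inB_linear : linear inB.
Proof. by move=> c u v; congr pair; rewrite /= scaler0 addr0. Qed.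

Let inS_linear : linear inS.
Proof. by move=> c u v; congr pair; rewrite /= scaler0 addr0. Qed.

Let linearHom (V W : vectType k) (h : 'Hom(V, W)) : linear h.
Proof. by move=> c u v; rewrite linearP. Qed.

Local Notation F := (double_iso B omega).

Lemma double_iso_ten x u :
  F (ten x u) = (ten x u.1, dtens_iso A B (ten (phi x) u.2)).
Proof.
rewrite /double_iso linfunE; last exact: tlift_linear.
have [tl tr] := ten_bilinear A B; have [tl' tr'] := ten_bilinear (dual A) (dual B).
rewrite tlift_ten //; split=> [v c y y'|y c v v']; congr pair => /=.
- exact: tl.
- by rewrite linearP tl' linearP.
- exact: tr.
- by rewrite tr' linearP.
Qed.

Lemma double_iso_inB T : F (tmap id inB T) = (T, 0).
Proof.
have [_ tr] := ten_bilinear (dual A) (dual B).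
move: T; apply: tens_ext => [c T T'|c T T'|x b].
- by rewrite tmap_linear linearP.
- by congr pair; rewrite /= scaler0 addr0.
rewrite tmap_ten // double_iso_ten /=.
by rewrite (bil0r (ten_bilinear _ _)) linear0.
Qed.

(** Locates g^* in the double: A^* ⊗ B^* enters A ⊗ B^* through the inverse of φ, which [F]
    undoes. *)
Lemma double_iso_inS S : F (tmap phi^-1%VF inS S) = (0, dtens_iso A B S).
Proof.
move: S; apply: tens_ext => [c T T'|c T T'|x b].
- by rewrite tmap_linear linearP.
- by congr pair; rewrite /= ?scaler0 ?addr0 // linearP.
rewrite (tmap_ten _ _ (linearHom _) inS_linear) double_iso_ten /= phiVK.
by rewrite (bil0r (ten_bilinear _ _)).
Qed.

Lemma double_isoK : cancel F F^-1%VF.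
Proof.
apply: lker0_lfunK.
(* [G] is an explicit left inverse of [F], assembled from the two inclusions; surjectivity follows
   in [double_isoVK] by counting dimensions. *)
pose G (P : dsum (tens A B) (dual (tens A B))) :=
  tmap id inB P.1 + tmap phi^-1%VF inS ((dtens_iso A B)^-1%VF P.2).
apply: (@lker0_can _ _ _ _ G); apply: tens_ext => [c T T'|//|x [b a]].
  by rewrite /G linearP /= linearP !tmap_linear scalerDr addrACA.
rewrite /G double_iso_ten /= dtens_isoK tmap_ten //.
rewrite (tmap_ten _ _ (linearHom _) inS_linear) phiK.
rewrite -(bilDr (ten_bilinear _ _)); congr ten.
by congr pair; rewrite /= ?addr0 ?add0r.
Qed.

Lemma dim_dsum (V W : vectType k) :
  \dim {:dsum V W} = (\dim {:V} + \dim {:W})%N.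
Proof. by rewrite !dimvf. Qed.

Lemma double_isoVK : cancel F^-1%VF F.
Proof.
apply: lker0_dimK; last exact: lker0_can double_isoK.
by rewrite dim_tens !dim_dsum !dim_dual dim_tens mulnDr.
Qed.

(** Invariance of ω, rewritten here and in the next three lemmas so that x is left alone in the
    first argument. *)
Lemma omega_succ x y z : omega (succ x y) z = - omega x (prec y z).
Proof.
have [_ _ _ anti wp ws] := HA.
by rewrite [omega x _]anti wp opprK ws.
Qed.

Lemma omega_prec x y z :
  omega (prec x y) z = omega x (prec y z) + omega x (succ y z).
Proof. by have [_ bo _ _ wp _] := HA; rewrite wp (bilDr bo). Qed.

Lemma omega_succ' x y z :
  omega (succ y x) z = omega x (prec z y) + omega x (succ z y).
Proof. by have [_ bo _ _ _ ws] := HA; rewrite ws (bilDr bo). Qed.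

Lemma omega_prec' x y z : omega (prec y x) z = - omega x (succ z y).
Proof.
have [_ _ _ anti wp ws] := HA; by rewrite [omega x _]anti opprK wp ws.
Qed.

(** Both summands of [Bs] carry a value of ω, with x and y exchanged in one of them; antisymmetry of
    ω supplies the minus sign of ω_d. *)
Lemma Bs_double_iso x y u v :
  Bs (F (ten x u)) (F (ten y v)) = omega x y * dsum_form u v.
Proof.
have [_ _ _ anti _ _] := HA.
by rewrite !double_iso_ten /Bs /= !dtens_isoE !dtenE !phiE (anti y) /dsum_form; ring.
Qed.

Variables (dl dr : B -> B -> B) (Dl Dr : B -> tens B B).
Hypothesis HB : diass_bialgebra dl dr Dl Dr.
Hypothesis char0 : [pchar k] =i pred0.

Let dlS := op_of_coop Dl.
Let drS := op_of_coop Dr.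
Local Notation ml := (manin_l dl dr dlS drS).
Local Notation mr := (manin_r dl dr dlS drS).

Let HBalg : diassociative dl dr. Proof. by case: HB. Qed.
Let HS : diassociative dlS drS.
Proof. by apply: diassociative_dual; case: HB. Qed.
Let HD : diassociative ml mr. Proof. exact: double_diassociative. Qed.
Let bl : bilinear_map dl. Proof. by case: HBalg. Qed.
Let br : bilinear_map dr. Proof. by case: HBalg. Qed.
Let blS : bilinear_map dlS. Proof. by case: HS. Qed.
Let brS : bilinear_map drS. Proof. by case: HS. Qed.
Let bml : bilinear_map ml. Proof. by case: HD. Qed.
Let bmr : bilinear_map mr. Proof. by case: HD. Qed.

Let HAS : dendriform (transport phi prec) (transport phi succ).
Proof. by apply: transport_dendriform HAd; exact: phiK. Qed.
Let bpS : bilinear_map (transport phi prec). Proof. by case: HAS. Qed.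
Let bsS : bilinear_map (transport phi succ). Proof. by case: HAS. Qed.

Let brd := tensor_bracket prec succ ml mr.
Let bbrd : bilinear_map brd. Proof. exact: tensor_bracket_bilinear. Qed.

Lemma Bs_double_inv P Q R : Bs (F (brd P Q)) (F R) = Bs (F P) (F (brd Q R)).
Proof.
have FP c u v : F (c *: u + v) = c *: F u + F v by rewrite linearP.
have lin := (bilPl bbrd, bilPr bbrd, FP, @BsPl k, @BsPr k).
move: P; apply: (@tens_ext _ _ _ k^o) => [d T T'|d T T'|x a]; rewrite ?lin //.
move: Q; apply: (@tens_ext _ _ _ k^o) => [d T T'|d T T'|y b]; rewrite ?lin //.
move: R; apply: (@tens_ext _ _ _ k^o) => [d T T'|d T T'|z e]; rewrite ?lin //.
have rotl := manin_rotl bl br blS brS; have rotr := manin_rotr bl br blS brS.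
(* [r1] to [r4] express the pairings on the right through those of the products of a and b, in both
   orders, against e; the ω lemmas do the opposite for the left side, so both sides meet. *)
have r1 : dsum_form a (mr b e) = dsum_form (ml a b) e.
  by rewrite dsum_formC rotr opprK.
have r2 : dsum_form a (ml b e) = dsum_form (ml a b) e - dsum_form (mr a b) e.
  by rewrite dsum_formC rotl opprB.
have r3 : dsum_form a (mr e b) = dsum_form (mr b a) e - dsum_form (ml b a) e.
  by rewrite dsum_formC rotr opprK rotl.
have r4 : dsum_form a (ml e b) = dsum_form (mr b a) e.
  by rewrite dsum_formC rotl rotr (rotl b a e); ring.
rewrite /brd !tensor_bracket_ten // !linearD !linearN /= !(BsDl, BsNl, BsDr, BsNr).
rewrite !Bs_double_iso r1 r2 r3 r4 omega_succ omega_prec omega_succ' omega_prec'.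
ring.
Qed.

Lemma double_lie_manin_triple :
  lie_manin_triple (bracket_double omega prec succ ml mr)
    (tensor_bracket prec succ dl dr) (bracket_dual omega prec succ dlS drS).
Proof.
split.
- apply: transport_lie; first exact: double_isoK.
  exact: tensor_bracket_lie.
- exact: tensor_bracket_lie.
- apply: transport_lie; first exact: dtens_isoK.
  exact: tensor_bracket_lie.
(* Pulled back along [F], the claim is that the inclusion of A ⊗ B preserves brackets. *)
- move=> x y; rewrite /bracket_double /transport -!double_iso_inB !double_isoK.
  congr (F _); symmetry; apply: tensor_bracket_morph => // u v.
    by rewrite /inB manin_l_incl.
  by rewrite /inB manin_r_incl.
(* Functionals on A ⊗ B are first written as tensors in A^* ⊗ B^*, to which the inverse of φ and
   [inS] apply. *)
- move=> a b; rewrite -[in LHS](dtens_isoVK a) -[in LHS](dtens_isoVK b).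
  rewrite /bracket_double {1}/transport -!double_iso_inS !double_isoK.
  congr (F _); symmetry.
  apply: tensor_bracket_morph => //; try exact: linearHom.
  + exact: (transport_invE phiK).
  + exact: (transport_invE phiK).
  + by move=> u v; rewrite /inS manin_l_inclS.
  by move=> u v; rewrite /inS manin_r_inclS.
move=> X Y Z; rewrite -[X]double_isoVK -[Y]double_isoVK -[Z]double_isoVK.
by rewrite /bracket_double /transport !double_isoK Bs_double_inv.
Qed.

End TensorManinTriple.

Theorem proposition5p19 (k : fieldType) (char0 : [pchar k] =i pred0)
    (A B : vectType k)
    (precA succA : A -> A -> A) (omega : A -> A -> k^o)
    (dlB drB : B -> B -> B) (Dl Dr : B -> tens B B)
    (HA : quadratic_dendriform precA succA omega)
    (HB : diass_bialgebra dlB drB Dl Dr) :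
  let dlS := op_of_coop Dl in
  let drS := op_of_coop Dr in
  let dld := manin_l dlB drB dlS drS in
  let drd := manin_r dlB drB dlS drS in
  let br_g := tensor_bracket precA succA dlB drB in
  let br_gS := bracket_dual omega precA succA dlS drS in
  let br_d := bracket_double omega precA succA dld drd in
  lie_manin_triple br_d br_g br_gS
  /\ lie_bialgebra br_g (coop_of_op br_gS).
Proof.
have triple := double_lie_manin_triple HA HB char0.
by split; last exact: manin_lie_bialgebra triple.
Qed.
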